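(* Let $a\le x<y\le y'<x'\le b$ be real numbers with $x+x'=y+y'$, let $\Omega=[x,y]\cup[y',x']$, let $f:[a,b]\to\mathbb{R}$ be convex, and let $p:[x,x']\to[0,\infty)$ be integrable and symmetric about $\frac{x+x'}{2}$. Let $\mathrm{Hp}_1,\mathrm{Hp}_2:[0,1]\to\mathbb{R}$ be the functions defined in the context. Then: (1) $\mathrm{Hp}_1$ and $\mathrm{Hp}_2$ are convex on $[0,1]$. (2) $\mathrm{Hp}_1$ is increasing on $[0,1]$, and the following hold for all $t\in[0,1]$: $$\frac{f(y)+f(y')}{2}\int_\Omega p(s)\,ds=\mathrm{Hp}_1(0)\le \mathrm{Hp}_1(t)\le \mathrm{Hp}_1(1)=\int_\Omega f(s)p(s)\,ds;$$ $$\mathrm{Hp}_1(t)\le t\int_\Omega f(s)p(s)\,ds+(1-t)\frac{f(y)+f(y')}{2}\int_\Omega p(s)\,ds\le\int_\Omega f(s)p(s)\,ds\le\frac{f(x)+f(x')}{2}\int_\Omega p(s)\,ds;$$ $$f\left(\frac{y+y'}{2}\right)\int_\Omega p(s)\,ds\le \mathrm{Hp}_2(t)\le t\int_\Omega f(s)p(s)\,ds+(1-t)\frac{f(y)+f(y')}{2}\int_\Omega p(s)\,ds\le\int_\Omega f(s)p(s)\,ds;$$ $$\mathrm{Hp}_2(t)\le \mathrm{Hp}_1(t).$$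
   Context: Symmetric about $\frac{x+x'}{2}$ means $p(s)=p(x+x'-s)$ for $s\in[x,x']$. ''Increasing'' is meant in the weak (non-strict) sense. For $t\in[0,1]$ define $$\mathrm{Hp}_1(t)=\int_x^y\left[f(ts+(1-t)y)+f(t(y+y'-s)+(1-t)y')\right]p(s)\,ds,$$ $$\mathrm{Hp}_2(t)=\int_x^y\left[f(ts+(1-t)y')+f(t(y+y'-s)+(1-t)y)\right]p(s)\,ds.$$ *)

(* Defs.v *)
(* MathComp-Analysis *)
From HB Require Import structures.
From mathcomp Require Import all_boot all_order all_algebra.
From mathcomp Require Import all_classical all_reals all_analysis.

Set Implicit Arguments.
Unset Strict Implicit.
Unset Printing Implicit Defensive.

Import Order.TTheory GRing.Theory Num.Theory.

Local Open Scope classical_set_scope.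
Local Open Scope ring_scope.

(* Integrals are taken with respect to the completed Lebesgue measure:
   [lebesgue_measure] lives on the Borel sigma-algebra and would only cover
   Borel-measurable weights, leaving out some Riemann-integrable ones. *)
Notation leb R := (@completed_lebesgue_measure R).

(* Functions on an interval are total functions on R whose values outside the
   interval are irrelevant. *)
Definition convex_on (R : realType) (a b : R) (f : R -> R) : Prop :=
  convex_function (`[a, b]%classic : set (convex_lmodType R^o)) (f : R^o -> R^o).

Definition integrable_on (R : realType) (a b : R) (p : R -> R) : Prop :=
  (leb R).-integrable `[a, b] (fun s => (p s)%:E).

Definition Omega (R : realType) (x x' y y' : R) : set R :=
  `[x, y] `|` `[y', x'].

Definition Hp1 (R : realType) (f p : R -> R) (x y y' t : R) : R :=
  \int[leb R]_(s in `[x, y])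
    ((f (t * s + (1 - t) * y) + f (t * (y + y' - s) + (1 - t) * y')) * p s).

Definition Hp2 (R : realType) (f p : R -> R) (x y y' t : R) : R :=
  \int[leb R]_(s in `[x, y])
    ((f (t * s + (1 - t) * y') + f (t * (y + y' - s) + (1 - t) * y)) * p s).

(* Main.v *)
(* With m = y + y' = x + x', the symmetry of p folds every integral over Omega
   onto [x, y], so that all quantities become integrals against p over [x, y] of
   sums f(c - d) + f(c + d), where c = m / 2 is fixed.  By convexity such a sum
   is nondecreasing in |d| and at least 2 f(c), which gives all the inequalities
   pointwise in s; convexity in t is also pointwise.  The folding needs the
   invariance of the completed Lebesgue measure under reflections. *)

Require Import Defs.
From HB Require Import structures.
From mathcomp Require Import all_boot all_order all_algebra.
From mathcomp Require Import all_classical all_reals all_analysis.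
From mathcomp Require Import measurable_realfun ring lra.

Set Implicit Arguments.
Unset Strict Implicit.
Unset Printing Implicit Defensive.

Import Order.TTheory GRing.Theory Num.Theory.

Local Open Scope classical_set_scope.
Local Open Scope ring_scope.

(* [R] seen with the sigma-algebra on which [leb R] is defined. *)
Local Notation lebT R := (caratheodory_type (wlength (@idfun R))^*%mu).

(** * Reflections preserve the completed Lebesgue measure *)

Lemma borel_completed (R : realType) (A : set R) :
  measurable A -> measurable (A : set (lebT R)).
Proof. exact: sub_caratheodory. Qed.

Lemma measurable_subr (R : realType) (c : R) :
  measurable_fun [set: measurableTypeR R]
    ((fun s : R => c - s) : measurableTypeR R -> measurableTypeR R).
Proof. exact: measurable_funB. Qed.

(** The image of Lebesgue measure under the reflection is a measure that gives each half-open
    interval its length, and this determines it. The reflection moves the closed end to the other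
    side, which leaves the length unchanged. *)
Lemma lebesgue_measure_reflect (R : realType) (c : R) (A : set R) :
  measurable A ->
  @lebesgue_measure R ((fun s : R => c - s) @^-1` A) = lebesgue_measure A.
Proof.
move=> mA; apply: esym; have mc := measurable_subr c.
apply: (@lebesgue_measure_unique R (pushforward (@lebesgue_measure R)
  ((fun s : R => c - s) : measurableTypeR R -> measurableTypeR R))) => //
  _ [[u v] _ <-] /=.
rewrite /pushforward.
have -> : (fun s : R => c - s) @^-1` [set` `]u, v]] = [set` `[c - v, c - u[].
  by apply/seteqP; split => s /=; rewrite !in_itv/= => /andP[? ?];
    apply/andP; split; lra.
rewrite !lebesgue_measure_itv/= !lte_fin.
have -> : (c - v < c - u) = (u < v) by lra.
by case: ifP => // _; rewrite -!EFinB; congr EFin; lra.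
Qed.

(** A set of the completed sigma-algebra is a Borel set together with part of a Borel null set. This
    bracketing reduces the completed measure to the Borel one. *)
Lemma completed_measurableP (R : realType) (A : set (lebT R)) :
  measurable A -> exists B N : set R, [/\ measurable B, measurable N,
    lebesgue_measure N = 0%E, B `<=` A & A `<=` B `|` N].
Proof.
rewrite -[measurable]completed_caratheodory_measurable.
rewrite g_sigma_completed_algebra_genE => -[B mB [N' [N [mN N0 NN]] <-]].
by exists B, N; split => //; exact: setUS.
Qed.

(** Converse of the bracketing: [A] is the union of [B] and [A \ B], and the latter lies in the null
    set [N]. Its measure is squeezed between those of [B] and of the union of [B] and [N]. *)
Lemma completed_measurableW (R : realType) (A B N : set R) :
  measurable B -> measurable N -> lebesgue_measure N = 0%E ->
  B `<=` A -> A `<=` B `|` N ->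
  measurable (A : set (lebT R)) /\ leb R A = lebesgue_measure B.
Proof.
move=> mB mN N0 BA ABN.
have mA : measurable (A : set (lebT R)).
  rewrite -[measurable]completed_caratheodory_measurable.
  rewrite g_sigma_completed_algebra_genE; exists B => //; exists (A `\` B).
    by exists N; split => // s [/ABN[]].
  by rewrite setDUK.
split=> //; apply/eqP; rewrite eq_le; apply/andP; split.
  have mN' := borel_completed mN; have mB' := borel_completed mB.
  apply: (@le_trans _ _ (leb R (B `|` N))).
    by apply: le_measure; rewrite ?inE//; exact: measurableU.
  apply: (le_trans (measureU2 _ _ _)) => //.
  by rewrite [X in (_ + X)%E](_ : _ = 0%E) ?adde0.
by apply: (@le_measure _ _ _ (leb R)); rewrite ?inE//; exact: borel_completed.
Qed.

(** The preimages of the bracketing Borel sets bracket the preimage of [A], with the same measures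
    by the Borel case. *)
Lemma completed_reflect (R : realType) (c : R) (A : set (lebT R)) :
  measurable A -> measurable ((fun s : R => c - s) @^-1` A : set (lebT R)) /\
  leb R ((fun s : R => c - s) @^-1` A) = leb R A.
Proof.
move=> /completed_measurableP[B [N [mB mN N0 BA ABN]]].
have [_ ->] := completed_measurableW mB mN N0 BA ABN.
have mr (C : set R) : measurable C -> measurable ((fun s : R => c - s) @^-1` C).
  by move=> mC; rewrite -[X in measurable X]setTI; exact: measurable_subr.
rewrite -(lebesgue_measure_reflect c mB).
apply: (@completed_measurableW _ _ _ ((fun s : R => c - s) @^-1` N));
  [exact: mr|exact: mr| |by move=> s /BA|by move=> s /ABN].
by rewrite lebesgue_measure_reflect.
Qed.

(** For nonnegative functions this is the change of variables for the image measure, which here is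
    [mu] itself; positive and negative parts give the general case. *)
Lemma integral_measure_preserving d (T : measurableType d) (R : realType)
    (mu : {measure set T -> \bar R}) (phi : T -> T) (D : set T)
    (g : T -> \bar R) :
  measurable_fun [set: T] phi ->
  (forall A, measurable A -> mu (phi @^-1` A) = mu A) ->
  measurable D -> measurable_fun D g ->
  (\int[mu]_(s in D) g s = \int[mu]_(s in phi @^-1` D) g (phi s))%E.
Proof.
move=> mphi muphi mD mg.
have ge0 (h : T -> \bar R) : measurable_fun D h -> (forall s, 0 <= h s)%E ->
    (\int[mu]_(s in D) h s = \int[mu]_(s in phi @^-1` D) (h \o phi) s)%E.
  move=> mh h0.
  have <- := ge0_integral_pushforward mphi mu mD mh (fun y _ => h0 y).
  by apply: eq_measure_integral => A mA _; exact/esym/muphi.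
rewrite integralE [RHS]integralE; congr (_ - _)%E; rewrite ge0//.
- by apply: eq_integral => s _; rewrite -funepos_comp.
- exact: measurable_funepos.
- by apply: eq_integral => s _; rewrite -funeneg_comp.
- exact: measurable_funeneg.
Qed.

Lemma integral_reflect (R : realType) (c : R) (D : set (lebT R))
    (g : lebT R -> \bar R) : measurable D -> measurable_fun D g ->
  (\int[leb R]_(s in D) g s =
   \int[leb R]_(s in (fun s : R => c - s)%R @^-1` D) g (c - s)%R)%E.
Proof.
pose phi : lebT R -> lebT R := fun s : R => c - s.
have mphi : measurable_fun [set: lebT R] phi.
  by move=> _ A mA; rewrite setTI; case: (completed_reflect c mA).
have muphi (A : set (lebT R)) : measurable A -> leb R (phi @^-1` A) = leb R A.
  by move=> mA; case: (completed_reflect c mA).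
exact: (@integral_measure_preserving _ _ _ (leb R) phi D g mphi muphi).
Qed.

(** * Convex functions on a segment *)

Lemma convex_onP (R : realType) (a b : R) (f : R -> R) :
  convex_on a b f <-> forall t u v, 0 <= t <= 1 -> a <= u <= b -> a <= v <= b ->
    f (t * u + (1 - t) * v) <= t * f u + (1 - t) * f v.
Proof.
split=> [cf t u v /andP[t0 t1] hu hv|cf t u v /set_mem hu /set_mem hv].
  apply: (cf (Itv01 t0 t1) u v); apply/mem_set => /=; by rewrite in_itv.
by apply: cf; rewrite ?ge0 ?le1//; move: hu hv; rewrite /= !in_itv.
Qed.

Lemma convex_on_sub (R : realType) (a b a' b' : R) (f : R -> R) :
  a <= a' -> b' <= b -> convex_on a b f -> convex_on a' b' f.
Proof.
move=> aa' bb' /convex_onP cf; apply/convex_onP => t u v ht hu hv.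
by apply: cf => //; lra.
Qed.

Lemma convex_onD (R : realType) (a b : R) (f g : R -> R) :
  convex_on a b f -> convex_on a b g -> convex_on a b (fun s => f s + g s).
Proof.
move=> /convex_onP cf /convex_onP cg; apply/convex_onP => t u v ht hu hv.
by have := cf t u v ht hu hv; have := cg t u v ht hu hv; lra.
Qed.

Lemma convex_on_affine (R : realType) (a b c d k m : R) (f : R -> R) :
  (forall s, c <= s <= d -> a <= k * s + m <= b) ->
  convex_on a b f -> convex_on c d (fun s => f (k * s + m)).
Proof.
move=> km /convex_onP cf; apply/convex_onP => t u v ht hu hv.
have -> : k * (t * u + (1 - t) * v) + m =
    t * (k * u + m) + (1 - t) * (k * v + m) by ring.
by apply: cf; rewrite ?km.
Qed.

Lemma segmentP (R : realFieldType) (u v z : R) : u <= z <= v ->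
  exists2 t, 0 <= t <= 1 & z = t * u + (1 - t) * v.
Proof.
move=> /andP[uz zv]; have [uv|vu] := ltP u v; last first.
  (* The segment is a single point, where the quotient used below would have denominator zero. *)
  by exists 1; [rewrite ler01 lexx | lra].
exists ((v - z) / (v - u)); last by field; rewrite subr_eq0 gt_eqF.
by rewrite divr_ge0 ?subr_ge0 ?(ltW uv)// ler_pdivrMr ?subr_gt0// mul1r; lra.
Qed.

Lemma convex_on_le_max (R : realType) (a b : R) (f : R -> R) (u v z : R) :
  convex_on a b f -> a <= u -> v <= b -> u <= z <= v ->
  f z <= Num.max (f u) (f v).
Proof.
move=> /convex_onP cf au vb /[dup] uzv /segmentP[t ht ->].
apply: (le_trans (cf t u v ht _ _)); [lra|lra|].
have -> : Num.max (f u) (f v) =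
  t * Num.max (f u) (f v) + (1 - t) * Num.max (f u) (f v) by ring.
by apply: lerD; apply: ler_wpM2l; rewrite ?le_max ?lexx ?orbT//; lra.
Qed.

(** Two-point case of Karamata's inequality. If [u] has weights [t] and [1 - t] on [u'] and [v'],
    the equality of sums gives [v] the weights [1 - t] and [t]; adding the two convexity
    inequalities makes each end point count once. *)
Lemma convex_on_majorization (R : realType) (a b : R) (f : R -> R)
    (u v u' v' : R) :
  convex_on a b f -> a <= u' -> v' <= b -> u' <= u <= v' -> u + v = u' + v' ->
  f u + f v <= f u' + f v'.
Proof.
move=> /convex_onP cf au' v'b /[dup] u'uv' /segmentP[t ht ut] uv.
have vt : v = (1 - t) * u' + (1 - (1 - t)) * v' by lra.
have := cf t u' v' ht; have := cf (1 - t) u' v'.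
by rewrite -ut -vt => c1 c2; have := c1 _ _ _; have := c2 _ _; lra.
Qed.

(** The larger end value [M] bounds [f] from above. Convexity at the midpoint of [s] and its mirror
    image [a + b - s], where [f] is also at most [M], gives the lower bound
    [2 * f ((a + b) / 2) - M]. *)
Lemma convex_on_bounded (R : realType) (a b : R) (f : R -> R) :
  convex_on a b f -> [bounded f s | s in `[a, b]].
Proof.
move=> cf; pose M := Num.max (f a) (f b).
exists (`|M| + `|2 * f ((a + b) / 2) - M|).
split=> [|N MN s]; first exact: num_real.
rewrite /= in_itv/= => hs; apply: (le_trans _ (ltW MN)).
have fM s' : a <= s' <= b -> f s' <= M.
  by apply: convex_on_le_max cf _ _.
have h1 := fM s hs; have h2 := fM (a + b - s) ltac:(lra).
move: cf => /convex_onP/(_ (1 / 2) s (a + b - s)).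
move=> /(_ ltac:(lra) hs ltac:(lra)).
have -> : 1 / 2 * s + (1 - 1 / 2) * (a + b - s) = (a + b) / 2 by field.
have := ler_norm M; have := ler_norm (- (2 * f ((a + b) / 2) - M)).
rewrite normrN ler_norml; have := normr_ge0 M.
have := normr_ge0 (2 * f ((a + b) / 2) - M); lra.
Qed.

(** * Convex functions integrated against the weight *)

Lemma measurable_completed_itv (R : realType) (i : interval R) :
  measurable ([set` i] : set (lebT R)).
Proof. by apply: borel_completed; exact: measurable_itv. Qed.

(** Strict sublevel sets of a convex function are intervals, hence Borel. Continuity would not do: a
    convex function may jump at [a] or [b]. *)
Lemma measurable_convex_on (R : realType) (a b : R) (f : R -> R) :
  convex_on a b f -> measurable_fun (`[a, b]%classic : set (lebT R)) f.
Proof.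
move=> cf.
apply: (measurability _ (RGenInftyO.measurableE R)) => _ [_ [r ->] <-].
apply: borel_completed; apply: is_interval_measurable => u v.
rewrite /= !in_itv/= => -[uab fu] [vab fv] z uzv; rewrite /= !in_itv/=.
split; first by lra.
apply: (le_lt_trans (convex_on_le_max cf _ _ uzv)); [lra|lra|].
by rewrite gt_max fu fv.
Qed.

Lemma integrable_convex_on (R : realType) (a b : R) (f p : R -> R) :
  convex_on a b f -> integrable_on a b p -> integrable_on a b (fun s => f s * p s).
Proof.
move=> cf ip.
exact: (integrableMr (measurable_completed_itv _) (measurable_convex_on cf)
  (convex_on_bounded cf) ip).
Qed.

Lemma integrable_onS (R : realType) (a b a' b' : R) (p : R -> R) :
  a <= a' -> b' <= b -> integrable_on a b p -> integrable_on a' b' p.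
Proof.
move=> aa' bb'; apply: integrableS; [exact: measurable_completed_itv..|].
by move=> s; rewrite /= !in_itv/= => hs; lra.
Qed.

(** The convexity inequality in the parameter holds for each [s], survives multiplication by
    [p s >= 0], and is then integrated. *)
Lemma convex_on_Rintegral (R : realType) (x y : R) (K : R -> R -> R) (p : R -> R) :
  (forall s, s \in `[x, y] -> 0 <= p s) ->
  (forall s, s \in `[x, y] -> convex_on 0 1 (K^~ s)) ->
  (forall t, 0 <= t <= 1 -> integrable_on x y (fun s => K t s * p s)) ->
  convex_on 0 1 (fun t => \int[leb R]_(s in `[x, y]) (K t s * p s)).
Proof.
move=> p0 cK iK; apply/convex_onP => t u v ht hu hv.
have mD := @measurable_completed_itv R `[x, y].
have iZ (k w : R) : 0 <= w <= 1 ->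
    (leb R).-integrable `[x, y] (fun s => (k * (K w s * p s))%:E).
  by move=> hw; have := integrableZl mD k (iK w hw); apply: eq_integrable.
rewrite -!RintegralZl//; try exact: iK.
rewrite -RintegralD//; try exact: iZ.
apply: le_Rintegral => //.
- by apply: iK; nra.
- by have := integrableD mD (iZ t u hu) (iZ (1 - t) v hv); apply: eq_integrable.
move=> s; rewrite /= => hs.
have -> : t * (K u s * p s) + (1 - t) * (K v s * p s) =
  (t * K u s + (1 - t) * K v s) * p s by ring.
by apply: ler_wpM2r; [exact: p0|move/convex_onP : (cK s hs); exact].
Qed.

(** * Folding integrals over [Omega] onto [[x, y]] *)

Lemma Rintegral_setU0 d (T : measurableType d) (R : realType)
    (mu : {measure set T -> \bar R}) (A B : set T) (g : T -> R) :
  measurable A -> measurable B -> mu (A `&` B) = 0%E ->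
  mu.-integrable (A `|` B) (EFin \o g) ->
  \int[mu]_(s in A `|` B) g s =
  \int[mu]_(s in A) g s + \int[mu]_(s in B) g s.
Proof.
move=> mA mB AB0 ig.
have mBA : measurable (B `\` A) by exact: measurableD.
(* Replacing [B] by [B \ A] makes the union disjoint and changes the integral over [B] only on a
   null set. *)
have ABE : A `|` (B `\` A) = A `|` B by rewrite setUDr setDv setD0.
rewrite -ABE Rintegral_setU ?ABE//.
- congr (_ + _); rewrite /Rintegral (negligible_integral _ mB _ AB0)//.
  + by rewrite setDIr setDv setU0.
  + exact: measurableI.
  + by apply: integrableS ig => //; exact: measurableU.
- rewrite disj_set2E; apply/eqP.
  by rewrite setDE setIA [A `&` B]setIC -setIA setICr setI0.
Qed.

(** Since [x + x' = y + y'], the reflection of centre [(x + x') / 2] exchanges [[x, y]] and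
    [[y', x']]. *)
Lemma Rintegral_Omega (R : realType) (x x' y y' : R) (g : R -> R) :
  x <= y -> y <= y' -> y' <= x' -> x + x' = y + y' -> integrable_on x x' g ->
  \int[leb R]_(s in Omega x x' y y') g s =
  \int[leb R]_(s in `[x, y]) g s + \int[leb R]_(s in `[x, y]) g (x + x' - s).
Proof.
move=> xy yy' y'x' xx' ig.
have mitv u v := @measurable_completed_itv R `[u, v].
(* The two intervals of [Omega] share a point when [y = y']. *)
rewrite Rintegral_setU0; [|exact: mitv|exact: mitv| |].
- congr (_ + _); congr fine; rewrite (@integral_reflect _ (x + x')).
  + congr (integral _ _ _); apply/seteqP; split => s /=;
    by rewrite !in_itv/= => hs; lra.
  + exact: mitv.
  + have xy' : x <= y' by lra.
    by have /integrableP[] := integrable_onS xy' (lexx x') ig.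
- apply: (@subset_measure0 _ _ _ (leb R) _ [set y']).
  + by apply: measurableI; exact: mitv.
  + by apply: borel_completed; exact: measurable_set1.
  + by move=> s [/=]; rewrite !in_itv/= => ? ?; lra.
  + exact: lebesgue_measure_set1.
- apply: integrableS ig; [exact: mitv|by apply: measurableU; exact: mitv|].
  by move=> s [/=|/=]; rewrite !in_itv/= => hs; lra.
Qed.

(** * The integrands of [Hp1] and [Hp2]: convexity and pointwise inequalities *)

Definition reflected_sum (R : realType) (f : R -> R) (m u v t s : R) : R :=
  f (t * s + (1 - t) * u) + f (t * (m - s) + (1 - t) * v).

Lemma conv_segment (R : realFieldType) (a b t u v : R) :
  0 <= t <= 1 -> a <= u <= b -> a <= v <= b -> a <= t * u + (1 - t) * v <= b.
Proof. by move=> /andP[? ?] /andP[? ?] /andP[? ?]; apply/andP; split; nra. Qed.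

Lemma conv_le_left (R : realFieldType) (t u v : R) :
  0 <= t <= 1 -> v <= u -> t * u + (1 - t) * v <= u.
Proof. by move=> /andP[? ?] ?; nra. Qed.

(** Convexity in [s] serves integrability: it makes the integrand bounded and measurable before
    multiplication by [p]. *)
Lemma convex_on_reflected_sum (R : realType) (a b c d m u v t : R) (f : R -> R) :
  convex_on a b f -> a <= u <= b -> a <= v <= b -> 0 <= t <= 1 ->
  (forall s, c <= s <= d -> a <= s <= b) ->
  (forall s, c <= s <= d -> a <= m - s <= b) ->
  convex_on c d (reflected_sum f m u v t).
Proof.
move=> cf hu hv ht hs hms; apply: convex_onD.
  apply: convex_on_affine cf => s hs1.
  exact: (conv_segment ht (hs _ hs1) hu).
have -> : (fun s => f (t * (m - s) + (1 - t) * v)) =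
          (fun s => f (- t * s + (t * m + (1 - t) * v))).
  by apply/funext => s; congr f; ring.
apply: convex_on_affine cf => s /hms hs'.
have -> : - t * s + (t * m + (1 - t) * v) = t * (m - s) + (1 - t) * v by ring.
exact: conv_segment.
Qed.

(** Convexity in [t] is what passes to [Hp1] and [Hp2] under the integral. Both arguments of [f] are
    affine in [t]. *)
Lemma convex_on_reflected_sum_weight (R : realType) (a b m u v s : R)
    (f : R -> R) :
  convex_on a b f -> a <= u <= b -> a <= v <= b -> a <= s <= b ->
  a <= m - s <= b -> convex_on 0 1 (fun t => reflected_sum f m u v t s).
Proof.
move=> cf hu hv hs hms; apply: convex_onD.
  have -> : (fun t => f (t * s + (1 - t) * u)) = (fun t => f ((s - u) * t + u)).
    by apply/funext => t; congr f; ring.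
  apply: convex_on_affine cf => t ht.
  have -> : (s - u) * t + u = t * s + (1 - t) * u by ring.
  exact: conv_segment.
have -> : (fun t => f (t * (m - s) + (1 - t) * v)) =
          (fun t => f ((m - s - v) * t + v)).
  by apply/funext => t; congr f; ring.
apply: convex_on_affine cf => t ht.
have -> : (m - s - v) * t + v = t * (m - s) + (1 - t) * v by ring.
exact: conv_segment.
Qed.

(** The arguments of [f] are [y - t * (y - s)] and [y' + t * (y - s)]: as [t] grows they move apart
    with constant sum, so majorization applies. *)
Lemma reflected_sum_le (R : realType) (a b x x' y y' s t u : R)
    (f : R -> R) (K := reflected_sum f (y + y')) :
  convex_on a b f -> a <= x -> x' <= b -> x + x' = y + y' -> y <= y' ->
  x <= s <= y -> 0 <= t -> t <= u -> u <= 1 ->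
  K y y' t s <= K y y' u s.
Proof.
move=> cf ax x'b xx' yy' /andP[xs sy] t0 tu u1.
(* These products have signs that linear arithmetic cannot find; given them, the positions of the
   four arguments follow linearly. *)
have ys : 0 <= (u - t) * (y - s) by apply: mulr_ge0; lra.
have hy : 0 <= u * (s - x) by apply: mulr_ge0; lra.
have hy' : 0 <= (1 - u) * (y - x) by apply: mulr_ge0; lra.
have ht : 0 <= t * (y - s) by apply: mulr_ge0; lra.
have hu : 0 <= u * (y - s) by apply: mulr_ge0; lra.
apply: (convex_on_majorization cf); [lra..| |ring].
by apply/andP; split; lra.
Qed.

(** Pairing the smaller of [s], [y + y' - s] with the larger of [y], [y'] puts both arguments
    between those of the other sum, with the same total. *)
Lemma reflected_sum_swap_le (R : realType) (a b x x' y y' s t : R)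
    (f : R -> R) (K := reflected_sum f (y + y')) :
  convex_on a b f -> a <= x -> x' <= b -> x + x' = y + y' -> y <= y' ->
  x <= s <= y -> 0 <= t <= 1 ->
  K y' y t s <= K y y' t s.
Proof.
move=> cf ax x'b xx' yy' /andP[xs sy] /andP[t0 t1].
have h1 : 0 <= t * (s - x) by apply: mulr_ge0; lra.
have h2 : 0 <= (1 - t) * (y - x) by apply: mulr_ge0; lra.
have h3 : 0 <= (1 - t) * (y' - y) by apply: mulr_ge0; lra.
have h4 : 0 <= t * (y + y' - s - s) by apply: mulr_ge0; lra.
apply: (convex_on_majorization cf); [lra..| |ring].
by apply/andP; split; lra.
Qed.

(** The two arguments of [f] have midpoint [(y + y') / 2]. *)
Lemma reflected_sum_mid_le (R : realType) (a b x x' y y' s t : R)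
    (f : R -> R) (K := reflected_sum f (y + y')) :
  convex_on a b f -> a <= x -> x' <= b -> x + x' = y + y' -> y <= y' ->
  x <= s <= y -> 0 <= t <= 1 ->
  2 * f ((y + y') / 2) <= K y' y t s.
Proof.
move=> cf ax x'b xx' yy' hs ht.
have h1 : a <= t * s + (1 - t) * y' <= b by apply: conv_segment; lra.
have h2 : a <= t * (y + y' - s) + (1 - t) * y <= b by apply: conv_segment; lra.
have h12 : 0 <= (1 / 2 : R) <= 1 by lra.
move: cf => /convex_onP cf; have := cf _ _ _ h12 h1 h2.
have -> : 1 / 2 * (t * s + (1 - t) * y') +
    (1 - 1 / 2) * (t * (y + y' - s) + (1 - t) * y) = (y + y') / 2 by field.
by rewrite /K /reflected_sum; lra.
Qed.

(** At [t = 1] the arguments are [s] and its mirror image, which lie between [x] and [x'] and have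
    the same sum. *)
Lemma reflected_sum1_le (R : realType) (a b x x' y y' s : R)
    (f : R -> R) (K := reflected_sum f (y + y')) :
  convex_on a b f -> a <= x -> x' <= b -> x + x' = y + y' -> y <= y' ->
  x <= s <= y -> K y y' 1 s <= f x + f x'.
Proof.
move=> cf ax x'b xx' yy' hs; apply: (convex_on_majorization cf) => //; [|lra].
by apply/andP; split; lra.
Qed.

(** * Integration of the pointwise inequalities *)

Theorem theorem1 (R : realType) (a b x x' y y' : R) (f p : R -> R)
    (hax : a <= x) (hxy : x < y) (hyy' : y <= y') (hy'x' : y' < x')
    (hx'b : x' <= b) (hsum : x + x' = y + y')
    (hf : convex_on a b f)
    (hp_ge0 : forall s, s \in `[x, x'] -> 0 <= p s)
    (hp_int : integrable_on x x' p)
    (hp_sym : forall s, s \in `[x, x'] -> p s = p (x + x' - s)) :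
  let H1 := Hp1 f p x y y' in
  let H2 := Hp2 f p x y y' in
  let Ip := \int[leb R]_(s in Omega x x' y y') p s in
  let Ifp := \int[leb R]_(s in Omega x x' y y') (f s * p s) in
  [/\ convex_on 0 1 H1, convex_on 0 1 H2,
      {in `[0, 1] &, {homo H1 : t u / t <= u}}
    & forall t, t \in `[0, 1] ->
      [/\ [/\ (f y + f y') / 2 * Ip = H1 0, H1 0 <= H1 t, H1 t <= H1 1
            & H1 1 = Ifp],
          [/\ H1 t <= t * Ifp + (1 - t) * ((f y + f y') / 2) * Ip,
              t * Ifp + (1 - t) * ((f y + f y') / 2) * Ip <= Ifp
            & Ifp <= (f x + f x') / 2 * Ip],
          [/\ f ((y + y') / 2) * Ip <= H2 t,
              H2 t <= t * Ifp + (1 - t) * ((f y + f y') / 2) * Ip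
            & t * Ifp + (1 - t) * ((f y + f y') / 2) * Ip <= Ifp]
        & H2 t <= H1 t]].
Proof.
have xy := ltW hxy; have y'x' := ltW hy'x'.
have i0 : 0 <= (0 : R) <= 1 by rewrite lexx ler01.
have i1 : 0 <= (1 : R) <= 1 by rewrite lexx ler01.
have [sxx' ms] : (forall s, x <= s <= y -> x <= s <= x') /\
    (forall s, x <= s <= y -> x <= y + y' - s <= x').
  by clear - xy hyy' y'x' hsum; split=> s; lra.
have sab s : x <= s <= x' -> a <= s <= b.
  by move=> /andP[xs sx']; rewrite (le_trans hax) ?(le_trans sx').
have yab : a <= y <= b by apply: sab; rewrite xy (le_trans hyy').
have y'ab : a <= y' <= b by apply: sab; rewrite y'x' (le_trans xy).
pose m := y + y'; pose K := reflected_sum f m.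
move=> H1 H2 Ip Ifp.
(* Both integrands are the same kernel, with [y] and [y'] exchanged for [H2]. *)
have H1E t : H1 t = \int[leb R]_(s in `[x, y]) (K y y' t s * p s) by [].
have H2E t : H2 t = \int[leb R]_(s in `[x, y]) (K y' y t s * p s) by [].
have hp0 s : s \in `[x, y] -> 0 <= p s.
  by rewrite in_itv/= => hs; apply: hp_ge0; rewrite in_itv; exact: sxx'.
have ip : integrable_on x y p.
  by apply: integrable_onS hp_int => //; exact: le_trans y'x'.
have cKs u v t : a <= u <= b -> a <= v <= b -> 0 <= t <= 1 ->
    convex_on x y (K u v t).
  move=> hu hv ht.
  by apply: (convex_on_reflected_sum hf) => // s hs; apply: sab;
    [exact: sxx'|exact: ms].
have cKt u v s : a <= u <= b -> a <= v <= b -> s \in `[x, y] ->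
    convex_on 0 1 (fun t => K u v t s).
  rewrite in_itv/= => hu hv hs.
  by apply: (convex_on_reflected_sum_weight hf) => //; apply: sab;
    [exact: sxx'|exact: ms].
have iK u v t : a <= u <= b -> a <= v <= b -> 0 <= t <= 1 ->
    integrable_on x y (fun s => K u v t s * p s).
  by move=> hu hv ht; apply: integrable_convex_on => //; exact: cKs.
have mxy := @measurable_completed_itv R `[x, y].
have leI (g h : R -> R) : integrable_on x y (fun s => g s * p s) ->
    integrable_on x y (fun s => h s * p s) ->
    (forall s, x <= s <= y -> g s <= h s) ->
    \int[leb R]_(s in `[x, y]) (g s * p s) <=
    \int[leb R]_(s in `[x, y]) (h s * p s).
  move=> ig ih gh; apply: le_Rintegral => // s hs.
  by apply: ler_wpM2r; [exact: hp0|apply: gh; move: hs; rewrite /= in_itv].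
have iC k : integrable_on x y (fun s => k * p s).
  by have := integrableZl mxy k ip; apply: eq_integrable.
have IC k : \int[leb R]_(s in `[x, y]) (k * p s) =
    k * \int[leb R]_(s in `[x, y]) p s by rewrite RintegralZl.
have pm s : s \in `[x, y] -> p (x + x' - s) = p s.
  by rewrite in_itv/= => hs; rewrite -hp_sym// in_itv; exact: sxx'.
have IpE : Ip = 2 * \int[leb R]_(s in `[x, y]) p s.
  rewrite /Ip (Rintegral_Omega xy hyy' y'x' hsum hp_int).
  under [X in _ + X = _]eq_Rintegral do [rewrite pm; last exact: set_mem].
  by ring.
(* Folding pairs [f s] with [f (x + x' - s)] under the common weight [p s], and their sum is the
   kernel at [t = 1]. *)
have IfpE : Ifp = \int[leb R]_(s in `[x, y]) (K y y' 1 s * p s).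
  have cxx' : convex_on x x' f by exact: convex_on_sub hf.
  have cr : convex_on x y (fun s => f (x + x' - s)).
    have -> : (fun s => f (x + x' - s)) = (fun s => f (-1 * s + (x + x'))).
      by apply/funext => s; congr f; ring.
    apply: convex_on_affine hf => s hs.
    by rewrite mulN1r addrC hsum; apply: sab; exact: ms.
  have cxy : convex_on x y f.
    by apply: convex_on_sub cxx' => //; exact: le_trans y'x'.
  have ifp := integrable_convex_on cxx' hp_int.
  rewrite /Ifp (Rintegral_Omega xy hyy' y'x' hsum ifp).
  under [X in _ + X = _]eq_Rintegral do [rewrite pm; last exact: set_mem].
  rewrite -RintegralD//; try exact: integrable_convex_on.
  apply: eq_Rintegral => s _; rewrite -mulrDl /K /reflected_sum /m -hsum.
  by congr ((f _ + f _) * _); ring.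
have cH1 : convex_on 0 1 H1.
  apply: convex_on_Rintegral => //; [|by move=> t ht; exact: iK].
  by move=> s hs; exact: cKt.
have cH2 : convex_on 0 1 H2.
  apply: convex_on_Rintegral => //; [|by move=> t ht; exact: iK].
  by move=> s hs; exact: cKt.
have H1_le t u : 0 <= t -> t <= u -> u <= 1 -> H1 t <= H1 u.
  move=> t0 tu u1; rewrite !H1E.
  have ht : 0 <= t <= 1 by rewrite t0 (le_trans tu).
  have hu : 0 <= u <= 1 by rewrite u1 (le_trans t0).
  apply: leI => [||s hs]; [exact: iK..|].
  exact: (reflected_sum_le hf hax hx'b hsum).
(* At [t = 0] the kernel is the constant [f y + f y']; the 2 from folding [Ip] cancels the half. *)
have H10 : (f y + f y') / 2 * Ip = H1 0.
  rewrite IpE mulrA divfK// -IC H1E; apply: eq_Rintegral => s _.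
  by rewrite /K /reflected_sum !mul0r !add0r subr0 !mul1r.
have H11 : H1 1 = Ifp by rewrite IfpE H1E.
have H21 t : 0 <= t <= 1 -> H2 t <= H1 t.
  move=> ht; rewrite H1E H2E; apply: leI => [||s hs]; [exact: iK..|].
  exact: (reflected_sum_swap_le hf hax hx'b hsum).
have Ifp_le : Ifp <= (f x + f x') / 2 * Ip.
  rewrite IpE mulrA divfK// -IC IfpE; apply: leI => [|//|s hs]; first exact: iK.
  exact: (reflected_sum1_le hf hax hx'b hsum).
have H2_ge t : 0 <= t <= 1 -> f ((y + y') / 2) * Ip <= H2 t.
  move=> ht; rewrite IpE mulrA -IC H2E; apply: leI => [//||s hs]; first exact: iK.
  by rewrite mulrC; exact: (reflected_sum_mid_le hf hax hx'b hsum).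
split=> //.
  move=> t u; rewrite !in_itv/= => /andP[t0 _] /andP[_ u1] tu; exact: H1_le.
move=> t; rewrite in_itv/= => ht; have /andP[t0 t1] := ht.
have L0 : H1 0 <= H1 t by exact: H1_le.
have L1 : H1 t <= H1 1 by exact: H1_le.
(* The middle expression is the chord of [H1] from [H1 0] to [H1 1]. It lies below [H1 1] by
   monotonicity, and above [H1] by convexity in [Lt]. *)
have Lc : t * Ifp + (1 - t) * ((f y + f y') / 2) * Ip <= Ifp.
  rewrite -mulrA H10 -H11; apply: conv_le_left => //; exact: le_trans L1.
have Lt : H1 t <= t * Ifp + (1 - t) * ((f y + f y') / 2) * Ip.
  rewrite -mulrA H10 -H11; move: (cH1) => /convex_onP/(_ t 1 0 ht i1 i0).
  by rewrite mulr1 mulr0 addr0.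
have L2 := H21 t ht.
split; [split => //..|exact: L2]; first exact: H2_ge.
exact: le_trans L2 Lt.
Qed.
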